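(* Let $k\ge 2$, let $\Omega\subset\mathbb{R}^k$ be a bounded open set, let $A\subset\Omega$ be a closed subset of a Lipschitz curve, and let $B$ be a closed subset of $\mathbb{R}^k$ with $B\cap\Omega\neq\emptyset$. Let $\beta_0>0$, let $\psi\colon(\beta_0,\infty)\to(0,\infty)$ be a concave increasing function with $\psi(t)\to\infty$ as $t\to\infty$, and let $\alpha>0$ be small enough that $g=\psi\circ\eta$ is well-defined on $(0,\alpha)$. Let $u$ be a subharmonic function on $\Omega\setminus B$ with $u(x)\le g(\operatorname{dist}(x,A\cup B))$ for all $x\in\Omega$ with $0<\operatorname{dist}(x,A\cup B)<\alpha$. (i) Suppose that for any $\beta>0$ there exists $\delta>0$ such that $t\mapsto g(t^\beta)$ is a convex function on $(0,\delta]$. If there are positive constants $c_1,c_2,\tau$ such that $$u(x)\le 2g(c_1\operatorname{dist}(x,B))-g(c_2\operatorname{dist}(x,B)),\qquad x\in\Omega,\ 0<\operatorname{dist}(x,B)<\tau,$$ then there are constants $v>0$ and $\tau_1>0$ such that $$u(x)\le g(v\operatorname{dist}(x,B)),\qquad x\in\Omega,\ 0<\operatorname{dist}(x,B)<\tau_1.$$ (ii) The convexity hypothesis in (i) is automatically fulfilled if $t\mapsto g(1/t)$ belongs to a Hardy field that contains the functions $f_\gamma(t)=t^\gamma$ for all $\gamma\in\mathbb{R}$.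
   Context: The function $\eta\colon(0,\infty)\to\mathbb{R}$ is $\eta(t)=t^{2-k}$ if $k>2$ and $\eta(t)=\log(1/t)$ if $k=2$. Write $x=(x',x'')\in\mathbb{R}^k$ with $x'\in\mathbb{R}$, $x''\in\mathbb{R}^{k-1}$. For $r,s>0$ put $\mathcal{C}(0,r,s)=(-r,r)\times B_{k-1}(0,s)$, where $B_{k-1}(0,s)$ is the open ball of radius $s$ in $\mathbb{R}^{k-1}$ centered at $0$. For $a\in\mathbb{R}^k$ let $T_a x=x+a$. A Lipschitz curve (1-dimensional Lipschitz surface) is a compact set $\Gamma\subset\mathbb{R}^k$ for which there are constants $L,R>0$ such that for any $a\in\Gamma$ there exist a Lipschitz function $\varphi\colon(-R,R)\to\mathbb{R}^{k-1}$ with Lipschitz constant at most $L$ and a $k\times k$ orthogonal matrix $U_a$ such that $\mathcal{C}(0,R,3LR)\cap U_aT_{-a}\Gamma$ equals the graph of $\varphi$. Hardy fields: consider real-valued functions defined on intervals $[M,+\infty)$, $M\in\mathbb{R}$, two of them being equivalent if they coincide on some interval $[M,+\infty)$. The equivalence classes (germs at $+\infty$) form a ring. A Hardy field is a subset of this ring that is a field and such that each of its classes contains a function differentiable on some $[M,+\infty)$ whose derivative also has its class in the subset. A function belongs to the Hardy field if its class does. Subharmonic functions are allowed to take the value $-\infty$. *)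

(* Defs.v *)
From HB Require Import structures.
From mathcomp Require Import all_boot all_order all_algebra.
From mathcomp Require Import all_classical all_reals all_analysis.

Set Implicit Arguments.
Unset Strict Implicit.
Unset Printing Implicit Defensive.

Import Order.TTheory GRing.Theory Num.Theory.
Import numFieldNormedType.Exports.

Local Open Scope classical_set_scope.
Local Open Scope ring_scope.

(* Points of R^n are column vectors.  The library norm on matrices is the sup
   norm: it induces the usual topology and bounded sets, but metric notions
   (balls, distances, Lipschitz constants) have to use the Euclidean norm. *)
Definition enorm (R : realType) (n : nat) (x : 'cV[R]_n) : R :=
  Num.sqrt (\sum_(i < n) x i 0 ^+ 2).

(* Only meaningful for S nonempty: inf set0 = 0. *)
Definition dist (R : realType) (n : nat) (x : 'cV[R]_n) (S : set 'cV[R]_n) : R :=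
  inf [set enorm (x - y) | y in S].

(* Meant for k >= 2 and t > 0. *)
Definition eta_k (R : realType) (k : nat) (t : R) : R :=
  if k == 2%N then ln t^-1 else t `^ (2 - k%:R).

(* R^(1 + m) is split as x = (x', x'') with x' = usubmx x and x'' = dsubmx x. *)
Definition cylinder (R : realType) (m : nat) (r s : R) : set 'cV[R]_(1 + m) :=
  [set x | `|usubmx x 0 0| < r /\ enorm (dsubmx x) < s].

Definition lipschitz_curve (R : realType) (m : nat)
    (Gamma : set 'cV[R]_(1 + m)) : Prop :=
  compact Gamma /\
  exists L r : R, [/\ 0 < L, 0 < r &
    forall a, Gamma a ->
    exists (phi : R -> 'cV[R]_m) (U : 'M[R]_(1 + m)),
    [/\ forall s t, `|s| < r -> `|t| < r ->
          enorm (phi s - phi t) <= L * `|s - t|,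
        U *m U^T = 1%:M &
        cylinder r (3 * L * r) `&` [set U *m (x - a) | x in Gamma] =
        [set col_mx t%:M (phi t) | t in [set t | `|t| < r]]]].

Definition partial (R : realType) (n : nat) (i : 'I_n.+1)
    (h : 'cV[R]_n.+1 -> R) : 'cV[R]_n.+1 -> R := 'D_(delta_mx i 0) h.

(* h is C^2 on the open set D with zero Laplacian; the values of h outside D
   are irrelevant. *)
Definition harmonic_on (R : realType) (n : nat) (D : set 'cV[R]_n.+1)
    (h : 'cV[R]_n.+1 -> R) : Prop :=
  forall x, D x ->
  [/\ {for x, continuous h},
      forall i, derivable h x (delta_mx i 0) /\ {for x, continuous (partial i h)},
      forall i j, derivable (partial i h) x (delta_mx j 0) /\
                  {for x, continuous (partial j (partial i h))} &
      \sum_(i < n.+1) partial i (partial i h) x = 0].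

(* Subharmonicity on an open set D, as domination by harmonic majorants: u is
   upper semicontinuous with values in [-oo, +oo[ and, for K compact in D, a
   function that is continuous on K, harmonic inside K and at least u on the
   boundary of K is at least u on K.  The function identically -oo is allowed. *)
Definition subharmonic_on (R : realType) (n : nat) (D : set 'cV[R]_n.+1)
    (u : 'cV[R]_n.+1 -> \bar R) : Prop :=
  [/\ forall x, D x -> (u x < +oo)%E,
      forall x (c : R), D x -> (u x < c%:E)%E -> \forall y \near x, (u y < c%:E)%E &
      forall (K : set 'cV[R]_n.+1) (h : 'cV[R]_n.+1 -> R),
        compact K -> K `<=` D ->
        {within K, continuous h} -> harmonic_on K° h ->
        (forall x, K x -> ~ K° x -> (u x <= (h x)%:E)%E) ->
        forall x, K x -> (u x <= (h x)%:E)%E].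

(* psi : ]beta0, +oo[ -> R is represented by a total function whose values on
   ]-oo, beta0] are irrelevant; [defined_at k beta0 t] says that psi (eta_k k t)
   does not depend on them. *)
Definition defined_at (R : realType) (k : nat) (beta0 t : R) : Prop :=
  0 < t /\ beta0 < eta_k k t.

Definition concave_on (R : realType) (D : set R) (f : R -> R) : Prop :=
  @convex_function R R^o D (fun t => - f t).

Definition power_convex (R : realType) (k : nat) (beta0 : R) (g : R -> R) :
    Prop :=
  forall beta : R, 0 < beta -> exists delta : R,
    [/\ 0 < delta,
        forall t, 0 < t <= delta -> defined_at k beta0 (t `^ beta) &
        @convex_function R R^o [set` `]0, delta]]
          (fun t => g (t `^ beta))].

(* A function on [M, +oo[ is represented by any of its total extensions, so
   that a set of germs at +oo is a set of total functions stable under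
   [germ_eq]. *)
Definition germ_eq (R : realType) (f g : R -> R) : Prop :=
  \forall t \near +oo, f t = g t.

Definition hardy_field (R : realType) (H : set (R -> R)) : Prop :=
  [/\ forall f g, germ_eq f g -> H f -> H g,
      H (fun=> 1) /\
        (forall f g, H f -> H g ->
          H (fun t => f t - g t) /\ H (fun t => f t * g t)),
      forall f, H f -> ~ germ_eq f (fun=> 0) ->
        exists2 g, H g & germ_eq (fun t => f t * g t) (fun=> 1) &
      forall f, H f -> exists g,
        [/\ germ_eq f g, \forall t \near +oo, derivable g t 1 & H (derive1 g)]].

(* Main.v *)
Require Import Defs.
From HB Require Import structures.
From mathcomp Require Import all_boot all_order all_algebra.
From mathcomp Require Import all_classical all_reals all_analysis.
From mathcomp Require Import interval_inference ring lra.

Import Order.TTheory GRing.Theory Num.Theory.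
Import numFieldNormedType.Exports.

Local Open Scope classical_set_scope.
Local Open Scope ring_scope.

(* Part (i) is a pointwise inequality between values of g.  If c1 < c2, choose
   beta with (3/2)^beta = c2 / c1 and put T = (c1 d)^(1/beta).
   The convex function G(t) = g(t^beta) takes the value g(c1 d) at T, which is
   the midpoint of T/2 and 3T/2, the value g(c2 d) at 3T/2, and the value
   g(v d), with v = c1 / 2^beta, at T/2; hence 2 g(c1 d) - g(c2 d) <= g(v d).
   If c2 <= c1, monotonicity of g suffices with v = c1.

   For part (ii) let h(x) = g(1/x) and gamma = 1 + 1/beta.  The element
   q(x) = x^gamma h'(x) of the Hardy field is eventually monotone.  Were it
   nonincreasing, h' would be at most a multiple of the integrable function
   x^(-gamma), so that h would be bounded above.  So q is nondecreasing, and
   then so is the derivative - beta q(t^(-beta)) of g(t^beta) = h(t^(-beta)),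
   because t^(-beta) decreases. *)

(** * Convexity from a monotone derivative *)

(** Unbundles the weight, which the library takes in [{i01 R}], into a real number [p] that can be
    computed with. *)
Lemma convex_functionRP {R : realType} {D : set R} {f : R -> R} :
  @convex_function R R^o D f <->
  forall p x y, 0 <= p <= 1 -> D x -> D y ->
    f (p * x + (1 - p) * y) <= p * f x + (1 - p) * f y.
Proof.
have num01 (t : {i01 R}) : 0 <= (t%:num : R) <= 1 by apply/andP; split.
split=> [fconv p x y /andP[p0 p1] Dx Dy|fconv t x y].
  have := fconv (Itv01 p0 p1) x y; rewrite !inE; exact.
rewrite !inE => Dx Dy; exact: (fconv _ _ _ (num01 t)).
Qed.

(** By the mean value theorem, the slopes of the chords to the left and to the right of an
    intermediate point [z] are values of [df] at points [c1 < z < c2], so they are ordered. *)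
Lemma derive_nondecreasing_convex {R : realType} {f} (df : R -> R) {a b : R} :
  (forall x, x \in `]a, b] -> is_derive x 1 f (df x)) ->
  {in `]a, b] &, {homo df : x y / x <= y}} ->
  @convex_function R R^o [set` `]a, b]] f.
Proof.
move=> fE df_nd.
have lt_convex (x y p : R) : x \in `]a, b] -> y \in `]a, b] -> x < y ->
    0 < p < 1 -> f (p * x + (1 - p) * y) <= p * f x + (1 - p) * f y.
  move=> xab yab xy /andP[p0 p1]; set z := _ + _.
  have ezx : z - x = (1 - p) * (y - x) by rewrite /z; ring.
  have eyz : y - z = p * (y - x) by rewrite /z; ring.
  have xz : x < z by rewrite -subr_gt0 ezx mulr_gt0 ?subr_gt0.
  have zy : z < y by rewrite -subr_gt0 eyz mulr_gt0 ?subr_gt0.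
  move: (xab) (yab); rewrite !in_itv/= => /andP[ax _] /andP[_ yb].
  have sub (u v w : R) : x <= u -> v <= y -> u <= w <= v -> w \in `]a, b].
    move=> xu vy /andP[uw wv]; rewrite in_itv/=.
    by rewrite (lt_le_trans ax (le_trans xu uw)) (le_trans wv (le_trans vy yb)).
  have mvt (u v : R) : x <= u -> v <= y -> u < v ->
      exists2 c, u < c < v & f v - f u = df c * (v - u).
    move=> xu vy uv.
    have fd w : w \in `]u, v[ -> is_derive w 1 f (df w).
      rewrite in_itv/= => /andP[uw wv].
      by apply: fE; apply: (sub u v) => //; rewrite !ltW.
    have fc : {within `[u, v], continuous f}.
      apply: derivable_within_continuous => w; rewrite in_itv/= => uwv.
      by have [] := fE w (sub u v w xu vy uwv).
    have [c] := MVT uv fd fc.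
    by rewrite in_itv/= => ? ?; exists c.
  have [c1 /andP[xc1 c1z] fxz] := mvt x z (lexx _) (ltW zy) xz.
  have [c2 /andP[zc2 c2y] fzy] := mvt z y (ltW xz) (lexx _) zy.
  have df12 : df c1 <= df c2.
    apply: df_nd.
    - by apply: (sub x z); rewrite ?lexx ?ltW.
    - by apply: (sub z y); rewrite ?lexx ?ltW.
    - exact: ltW (lt_trans c1z zc2).
  rewrite ezx in fxz; rewrite eyz in fzy.
  (* The convexity gap is a nonnegative multiple of the difference of the two slopes. *)
  have e : p * f x + (1 - p) * f y - f z =
      p * (1 - p) * (y - x) * (df c2 - df c1).
    have -> : f x = f z - df c1 * ((1 - p) * (y - x)) by rewrite -fxz; ring.
    have -> : f y = f z + df c2 * (p * (y - x)) by rewrite -fzy; ring.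
    by ring.
  rewrite -subr_ge0 e !mulr_ge0 ?subr_ge0 ?(ltW (lt_trans xz zy))//.
  - exact: ltW.
  - exact: ltW.
(* The weights 0 and 1 and the case [x = y] are trivial; if [y < x], exchange the points and replace
   [p] by [1 - p]. *)
apply/convex_functionRP => p x y /andP[p0 p1] /= xab yab.
have [->|pN0] := eqVneq p 0; first by rewrite !mul0r !add0r subr0 !mul1r.
have [->|pN1] := eqVneq p 1; first by rewrite !mul1r subrr !mul0r !addr0.
have {}p0 : 0 < p by rewrite lt0r pN0.
have {}p1 : p < 1 by rewrite lt_neqAle pN1.
have [xy|yx|->] := ltgtP x y.
- by apply: lt_convex; rewrite ?p0.
- have := @lt_convex y x (1 - p) yab xab yx.
  rewrite subKr (addrC (_ * y)) (addrC (_ * f y)); apply.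
  by rewrite subr_gt0 p1 /= ltrBlDr ltrDl.
- by rewrite -!mulrDl addrCA subrr addr0 !mul1r.
Qed.

(** * Eventual sign and monotonicity in Hardy fields *)

(** An element with nonzero germ is invertible, hence eventually without zeros; its differentiable
    representative is continuous, so the intermediate value theorem forbids a change of sign. *)
Lemma hardy_field_sign {R : realType} {H : set (R -> R)} {f : R -> R} :
  hardy_field H -> H f ->
  (\forall t \near +oo, 0 <= f t) \/ (\forall t \near +oo, f t <= 0).
Proof.
move=> [_ _ Hinv Hder] Hf.
have [f0|fN0] := pselect (germ_eq f (fun=> 0)).
  by left; apply: filterS f0 => t ->.
have [g _ fg1] := Hinv f Hf fN0.
have [h [fh dh _]] := Hder f Hf.
have : \forall t \near +oo, h t != 0 /\ (f t = h t /\ derivable h t 1).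
  near=> t; have fht : f t = h t by near: t.
  split; last by split=> //; near: t.
  rewrite -fht; apply/eqP => ft0; have : f t * g t = 1 by near: t.
  by rewrite ft0 mul0r => /esym/eqP; rewrite oner_eq0.
move=> [M [_ hM]].
have no_change (x y : R) : M < x -> x <= y ->
    Num.min (h x) (h y) <= 0 <= Num.max (h x) (h y) -> False.
  move=> Mx xy /IVT -[//||c].
    apply: derivable_within_continuous => z; rewrite in_itv/= => /andP[xz _].
    by have [_ []] := hM z (lt_le_trans Mx xz).
  rewrite in_itv/= => /andP[xc _] hc0.
  by have [] := hM c (lt_le_trans Mx xc); rewrite hc0 eqxx.
(* The eventual properties hold only strictly beyond [M], so the sign is read off at [M + 1]. *)
have M1 : M < M + 1 by rewrite ltrDl.
have hf (t : R) : M + 1 <= t -> f t = h t.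
  by move=> Mt; have [_ []] := hM t (lt_le_trans M1 Mt).
have [h0|h0] := leP 0 (h (M + 1)); [left|right].
  near=> t; have Mt : M + 1 <= t by near: t; apply: nbhs_pinfty_ge;
    rewrite num_real.
  rewrite hf// leNgt; apply/negP => ht.
  apply: (no_change _ _ M1 Mt).
  by rewrite ge_min le_max (ltW ht) h0 orbT.
near=> t; have Mt : M + 1 <= t by near: t; apply: nbhs_pinfty_ge;
  rewrite num_real.
rewrite hf// leNgt; apply/negP => ht.
apply: (no_change _ _ M1 Mt).
by rewrite ge_min le_max (ltW ht) (ltW h0) orbT.
Unshelve. all: by end_near. Qed.

(** The derivative of a differentiable representative is again in the field, so it has an eventual
    sign. *)
Lemma hardy_field_monotone {R : realType} {H : set (R -> R)} {f : R -> R} :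
  hardy_field H -> H f ->
  exists M : R, (forall x y, M <= x -> x <= y -> f x <= f y) \/
                (forall x y, M <= x -> x <= y -> f y <= f x).
Proof.
move=> HH Hf; have [_ _ _ /(_ f Hf)[h [fh dh Hh']]] := HH.
(* Gathers the eventual facts on one half-line, with [P] standing for either sign condition. *)
have key (P : R -> Prop) : (\forall t \near +oo, P (derive1 h t)) ->
    exists M : R, [/\ forall t, M <= t -> f t = h t,
      forall t, t \in `]M, +oo[ -> derivable h t 1,
      forall t, t \in `]M, +oo[ -> P (derive1 h t) &
      {within `[M, +oo[, continuous h}].
  move=> hP; have : \forall t \near +oo,
      f t = h t /\ (derivable h t 1 /\ P (derive1 h t)).
    by near=> t; split; [near: t|split; near: t].
  move=> [M [_ hM]]; exists (M + 1).
  have M1 t : M + 1 <= t -> M < t by apply: lt_le_trans; rewrite ltrDl.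
  split=> [t /M1/hM[]//|t|t|].
  - by rewrite in_itv/= andbT => /ltW/M1/hM[_ []].
  - by rewrite in_itv/= andbT => /ltW/M1/hM[_ []].
  - apply: derivable_within_continuous => t.
    by rewrite in_itv/= andbT => /M1/hM[_ []].
have [/(key (fun r => 0 <= r))|/(key (fun r => r <= 0))] :=
  hardy_field_sign HH Hh' => -[M [fE dhM sgn hc]]; exists M.
  left=> x y Mx xy; rewrite !fE//; last exact: le_trans xy.
  exact: (ger0_derive1_ndecry dhM sgn hc).
right=> x y Mx xy; rewrite !fE//; last exact: le_trans xy.
exact: (ler0_derive1_nincry dhM sgn hc).
Unshelve. all: by end_near. Qed.

(** * Boundedness from an integrable bound on the derivative *)

(** The derivative is at most [D x^(-gamma)]. Subtracting the antiderivative of this bound, which is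
    [- D / (gamma - 1) x^(1 - gamma)], from [h] gives a nonincreasing function [F], and
    [h x <= F x <= F M]. *)
Lemma bounded_of_powR_derive1 {R : realType} {h : R -> R} {gamma M : R} :
  1 < gamma -> 0 < M ->
  (forall x, M <= x -> derivable h x 1) ->
  (forall x y, M <= x -> x <= y ->
     y `^ gamma * derive1 h y <= x `^ gamma * derive1 h x) ->
  exists C : R, forall x, M <= x -> h x <= C.
Proof.
move=> gamma1 M0 dh qnincr.
(* The maximum with 0 makes the term added to [h] in [F] nonnegative. *)
pose D := Num.max 0 (M `^ gamma * derive1 h M).
have D0 : 0 <= D by rewrite le_max lexx.
pose F x := h x + D / (gamma - 1) * x `^ (1 - gamma).
have gN0 : gamma - 1 != 0 by rewrite subr_eq0 gt_eqF.
have FE x : M <= x -> is_derive x 1 F (derive1 h x - D * x `^ (- gamma)).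
  move=> Mx; have x0 := lt_le_trans M0 Mx.
  have hx : is_derive x 1 h (derive1 h x).
    by rewrite derive1E; apply: DeriveDef => //; exact: dh.
  have px := @is_derive1_powR R (1 - gamma) x x0.
  apply: is_derive_eq.
  rewrite -[_ *: _]/(_ * _); congr (_ + _).
  rewrite -addrA (addrC (- gamma)) addrA subrr add0r.
  by field.
have dF x : M <= x -> derivable F x 1 by move=> /FE[].
have F_nincr x : M <= x -> F x <= F M.
  move=> Mx; apply: (@ler0_derive1_nincry R F M) => //.
  - by move=> y; rewrite in_itv/= andbT => /ltW/dF.
  - move=> y; rewrite in_itv/= andbT => /ltW My.
    rewrite derive1E (@derive_val _ _ _ _ _ _ _ (FE y My)) subr_le0 powRN.
    rewrite ler_pdivlMr ?powR_gt0 ?(lt_le_trans M0)// mulrC le_max.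
    by rewrite (qnincr M y) ?orbT.
  - apply: derivable_within_continuous => y.
    by rewrite in_itv/= andbT => /dF.
exists (F M) => x Mx; apply: le_trans (F_nincr x Mx).
rewrite lerDl mulr_ge0 ?powR_ge0// divr_ge0//.
by rewrite subr_ge0 ltW.
Qed.

(** * Monotonicity and divergence of [eta_k] *)

Lemma eta_k_le {R : realType} {k : nat} {s t : R} :
  (2 <= k)%N -> 0 < s -> s <= t -> eta_k k t <= eta_k k s.
Proof.
move=> k2 s0 st; have t0 := lt_le_trans s0 st; rewrite /eta_k; case: ifP => _.
  by rewrite ler_ln ?posrE ?invr_gt0// lef_pV2 ?posrE.
rewrite -opprB !powRN lef_pV2 ?posrE ?powR_gt0//.
by rewrite ge0_ler_powR ?nnegrE ?subr_ge0 ?ler_nat ?(ltW s0) ?(ltW t0).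
Qed.

Lemma eta_k_inv_pinfty {R : realType} {k : nat} :
  (2 <= k)%N -> eta_k k (x^-1 : R) @[x --> +oo] --> +oo.
Proof.
move=> k2; apply/cvgryPgt => C; rewrite /eta_k; case: (eqVneq k 2%N) => [_|kN2].
  by near=> x; rewrite invrK -[C]expRK ltr_ln ?posrE ?expR_gt0.
near=> x; have x1 : 1 <= x by near: x; apply: nbhs_pinfty_ge; rewrite num_real.
have x0 : 0 < x by exact: lt_le_trans x1.
(* Here [k >= 3], so [eta_k k (1 / x) = x^(k - 2) >= x] for [x >= 1]. *)
apply: (@lt_le_trans _ _ x).
  by near: x; apply: nbhs_pinfty_gt; rewrite num_real.
rewrite -opprB powRN -(powR_inv1 (ltW x0)) -powRrM mulN1r powRN invrK.
apply: le1r_powR => //; rewrite lerBrDr -(natrD R 1 2).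
by rewrite ler_nat addn2 ltn_neqAle eq_sym kN2.
Unshelve. all: by end_near. Qed.

(** * The pointwise inequality for part (i) *)

Lemma power_convex_bound {R : realType} {k : nat} {beta0 : R} {g : R -> R}
    {c1 c2 : R} :
  power_convex k beta0 g -> 0 < c1 -> c1 < c2 ->
  exists v delta : R, [/\ 0 < v, 0 < delta &
    forall d, 0 < d < delta -> defined_at k beta0 (v * d) /\
      2 * g (c1 * d) - g (c2 * d) <= g (v * d)].
Proof.
move=> gconv c10 c12; have c20 := lt_trans c10 c12.
have ln32 : 0 < ln (3 / 2 : R) by apply: ln_gt0; lra.
pose beta := ln (c2 / c1) / ln (3 / 2).
have beta_gt0 : 0 < beta by rewrite divr_gt0// ln_gt0// ltr_pdivlMr ?mul1r.
have betaN0 : beta != 0 by rewrite gt_eqF.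
have pow32 : (3 / 2 : R) `^ beta = c2 / c1.
  rewrite /powR ifF; last by apply/negbTE; lra.
  rewrite divfK ?gt_eqF// lnK// posrE divr_gt0//.
have [delta [delta_gt0 def /convex_functionRP conv_g]] := gconv beta beta_gt0.
(* The bound on [d] says [c2 d < delta^beta], which places [3T/2], and with it [T/2], in the
   interval of convexity. *)
exists (2^-1 `^ beta * c1), (delta `^ beta / c2).
split; first by rewrite mulr_gt0 ?powR_gt0.
  by rewrite divr_gt0 ?powR_gt0.
move=> d /andP[d0 dlt].
pose T := (c1 * d) `^ beta^-1.
have T0 : 0 < T by rewrite powR_gt0// mulr_gt0.
have Tbeta : T `^ beta = c1 * d.
  by rewrite -powRrM mulVf// powRr1// ltW// mulr_gt0.
have T1 : (2^-1 * T) `^ beta = 2^-1 `^ beta * c1 * d.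
  by rewrite powRM ?invr_ge0 ?(ltW T0)// Tbeta mulrA.
have T2 : (3 / 2 * T) `^ beta = c2 * d.
  rewrite powRM ?divr_ge0 ?(ltW T0)//.
  by rewrite Tbeta pow32 mulrA divfK ?gt_eqF.
have Tdelta : 3 / 2 * T <= delta.
  rewrite leNgt; apply/negP => /(gt0_ltr_powR beta_gt0).
  rewrite !nnegrE !ltW ?mulr_gt0 ?divr_gt0// => /(_ isT isT).
  by rewrite T2 ltNge mulrC -ler_pdivlMr// ltW.
have T1in : 0 < 2^-1 * T <= delta by lra.
split; first by rewrite -T1; exact: def.
have T2in : 0 < 3 / 2 * T <= delta by rewrite Tdelta andbT; lra.
have half01 : 0 <= (2^-1 : R) <= 1 by lra.
have /= := conv_g _ _ _ half01 T1in T2in.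
have -> : 2^-1 * (2^-1 * T) + (1 - 2^-1) * (3 / 2 * T) = T by lra.
by rewrite T1 T2 Tbeta; lra.
Qed.

(** * Convexity in the Hardy field case *)

Lemma hardy_power_convex {R : realType} {k : nat} {beta0 alpha : R}
    {g : R -> R} {H : set (R -> R)} :
  0 < alpha -> (forall t, 0 < t < alpha -> defined_at k beta0 t) ->
  g x^-1 @[x --> +oo] --> +oo ->
  hardy_field H -> (forall gamma : R, H (fun t => t `^ gamma)) ->
  H (fun t => g t^-1) -> power_convex k beta0 g.
Proof.
move=> alpha0 def gy HH Hpow Hg beta beta_gt0.
have betaN0 : beta != 0 by rewrite gt_eqF.
have [_ [_ Hring] _ /(_ _ Hg)[h [gh dh Hh']]] := HH.
(* With [x = t^(-beta)] one has [x^gamma = t^(-beta - 1)], the power produced by the chain rule for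
   [h (t^(-beta))]. *)
pose gamma := 1 + beta^-1.
have gamma1 : 1 < gamma by rewrite ltrDl invr_gt0.
pose q x := x `^ gamma * derive1 h x.
have Hq : H q by have [_] := Hring _ _ (Hpow gamma) Hh'.
have [M0 q_mono] := hardy_field_monotone HH Hq.
have : \forall t \near +oo, M0 <= t /\ (g t^-1 = h t /\ derivable h t 1).
  near=> t; split; last by split; near: t.
  by near: t; apply: nbhs_pinfty_ge; rewrite num_real.
move=> [M1 [_ hM1]].
(* The first term gives points strictly beyond [M1]; the second gives [1 / N <= alpha / 2 < alpha],
   where [g] is well-defined. *)
pose N := Num.max (M1 + 1) (2 / alpha).
have N0 : 0 < N by rewrite lt_max divr_gt0 ?orbT.
have hN x : N <= x -> M0 <= x /\ (g x^-1 = h x /\ derivable h x 1).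
  rewrite ge_max => /andP[M1x _]; apply: hM1.
  by apply: lt_le_trans M1x; rewrite ltrDl.
have q_nd x y : N <= x -> x <= y -> q x <= q y.
  case: q_mono => q_mono Nx xy; first by apply: q_mono => //; have [] := hN x Nx.
  (* In the nonincreasing case [h] would be bounded above, contradicting the divergence of
     [g (1 / x)]. *)
  have [x' /hN[_ [_ dhx']]|x' y' /hN[M0x' _] x'y'|C hC] :=
    @bounded_of_powR_derive1 R h gamma N gamma1 N0.
  - exact: dhx'.
  - exact: q_mono.
  have /filter_ex[z [Nz Cz]] : \forall z \near +oo, N <= z /\ C < g z^-1.
    near=> z; split; first by near: z; apply: nbhs_pinfty_ge; rewrite num_real.
    by near: z; move/cvgryPgt : gy; exact.
  have [_ [gz _]] := hN z Nz.
  by move: Cz; rewrite gz ltNge hC.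
(* This is the value of [t] at which [t^(-beta) = N]. *)
exists (N `^ (- beta^-1)).
have le_pow t : 0 < t -> t <= N `^ (- beta^-1) -> N <= t `^ (- beta).
  move=> t0 tN.
  have -> : N = (N `^ (- beta^-1)) `^ (- beta).
    by rewrite -powRrM mulrNN mulVf// powRr1// ltW.
  rewrite !(powRN _ beta) lef_pV2 ?posrE ?powR_gt0//.
  by rewrite ge0_ler_powR ?nnegrE ?powR_ge0// ltW.
split; first by rewrite powR_gt0.
  move=> t /andP[t0 tN]; apply: def; rewrite powR_gt0//=.
  have := le_pow t t0 tN; rewrite powRN => NV.
  have : 2 / alpha <= (t `^ beta)^-1.
    by apply: le_trans NV; rewrite le_max lexx orbT.
  rewrite -[2 / alpha]invrK lef_pV2 ?posrE ?powR_gt0 ?invr_gt0 ?divr_gt0//.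
  rewrite invf_div => /le_lt_trans; apply; lra.
(* Convexity is proved for the differentiable representative [h] and then carried over to [g], which
   agrees with it on this interval. *)
have h_conv : @convex_function R R^o [set` `]0, N `^ (- beta^-1)]]
    (fun t => h (t `^ (- beta))).
  apply: (derive_nondecreasing_convex (fun t => - beta * q (t `^ - beta))).
    move=> t; rewrite in_itv/= => /andP[t0 tN].
    have [_ [_ dht]] := hN _ (le_pow t t0 tN).
    have hx : is_derive (t `^ (- beta)) 1 h (derive1 h (t `^ (- beta))).
      by rewrite derive1E; apply: DeriveDef.
    have px := @is_derive1_powR R (- beta) t t0.
    have -> : - beta * q (t `^ (- beta)) =
        derive1 h (t `^ (- beta)) * (- beta * t `^ (- beta - 1)).
      rewrite /q -powRrM.
      have -> : - beta * gamma = - beta - 1.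
        by rewrite /gamma mulrDr mulr1 mulNr divff.
      by ring.
    exact: (@is_derive1_comp _ h (fun s => s `^ (- beta)) t _ _ hx px).
  move=> s t; rewrite !in_itv/= => /andP[s0 sN] /andP[t0 tN] st.
  rewrite ler_nM2l ?oppr_lt0//; apply: q_nd; first exact: le_pow.
  rewrite !(powRN _ beta) lef_pV2 ?posrE ?powR_gt0//.
  by rewrite ge0_ler_powR ?nnegrE ?(ltW s0) ?(ltW t0) ?(ltW beta_gt0).
have g_h t : `]0, N `^ (- beta^-1)]%classic t ->
    g (t `^ beta) = h (t `^ (- beta)).
  rewrite /= in_itv/= => /andP[t0 tN]; have [_ [<- _]] := hN _ (le_pow t t0 tN).
  by rewrite powRN invrK.
move: h_conv => /convex_functionRP h_conv.
apply/convex_functionRP => p x y p01 xD yD.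
have zD : `]0, N `^ (- beta^-1)]%classic (p * x + (1 - p) * y).
  move: xD yD p01; rewrite /= !in_itv/= => /andP[x0 xN] /andP[y0 yN].
  move=> /andP[p0 p1]; apply/andP; split; nra.
by rewrite !g_h//; exact: h_conv.
Unshelve. all: by end_near. Qed.

(* The dimension is k = 1 + m. *)
Theorem mainTheorem2 (R : realType) (m : nat) (hk : (2 <= 1 + m)%N)
    (Omega A B : set 'cV[R]_(1 + m))
    (Omega_bounded : bounded_set Omega) (Omega_open : open Omega)
    (A_sub_Omega : A `<=` Omega) (A_closed : closed A)
    (A_curve : exists2 Gamma : set 'cV[R]_(1 + m),
                 lipschitz_curve Gamma & A `<=` Gamma)
    (B_closed : closed B) (B_meets_Omega : B `&` Omega !=set0)
    (beta0 : R) (beta0_gt0 : 0 < beta0)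
    (psi : R -> R)
    (psi_gt0 : forall t, beta0 < t -> 0 < psi t)
    (psi_concave : concave_on [set` `]beta0, +oo[] psi)
    (psi_incr : forall s t, beta0 < s -> s <= t -> psi s <= psi t)
    (psi_pinfty : psi t @[t --> +oo] --> +oo)
    (g : R -> R) (gE : g = psi \o eta_k (1 + m)%N)
    (alpha : R) (alpha_gt0 : 0 < alpha)
    (g_defined : forall t, 0 < t < alpha -> defined_at (1 + m)%N beta0 t)
    (u : 'cV[R]_(1 + m) -> \bar R)
    (u_subharmonic : subharmonic_on (Omega `\` B) u)
    (u_le_g : forall x, Omega x -> 0 < dist x (A `|` B) < alpha ->
                (u x <= (g (dist x (A `|` B)))%:E)%E) :
  (power_convex (1 + m)%N beta0 g ->
   forall c1 c2 tau : R, 0 < c1 -> 0 < c2 -> 0 < tau ->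
   (forall x, Omega x -> 0 < dist x B < tau ->
      [/\ defined_at (1 + m)%N beta0 (c1 * dist x B),
          defined_at (1 + m)%N beta0 (c2 * dist x B) &
          (u x <= (2 * g (c1 * dist x B) - g (c2 * dist x B))%:E)%E]) ->
   exists v tau1 : R, [/\ 0 < v, 0 < tau1 &
     forall x, Omega x -> 0 < dist x B < tau1 ->
       defined_at (1 + m)%N beta0 (v * dist x B) /\
       (u x <= (g (v * dist x B))%:E)%E])
  /\
  ((exists H : set (R -> R),
      [/\ hardy_field H,
          forall gamma : R, H (fun t => t `^ gamma) &
          H (fun t => g t^-1)]) ->
   power_convex (1 + m)%N beta0 g).
Proof.
split; last first.
  move=> [H [HH Hpow Hg]].
  have gy : g x^-1 @[x --> +oo] --> +oo.
    (* Both [eta_k (1 + m) (1 / x)] and [psi] tend to infinity. *)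
    by rewrite gE; exact: cvg_comp (eta_k_inv_pinfty hk) psi_pinfty.
  exact: (hardy_power_convex alpha_gt0 g_defined gy HH Hpow Hg).
move=> gconv c1 c2 tau c10 c20 tau0 u_le.
have [c12|c21] := ltP c1 c2.
  have [v [delta [v0 delta0 gv]]] := power_convex_bound gconv c10 c12.
  exists v, (Num.min tau delta); split; rewrite ?lt_min ?tau0//.
  move=> x Ox; rewrite lt_min => /andP[d0 /andP[dtau ddelta]].
  have [|def_v le_v] := gv (dist x B); first by rewrite d0.
  split=> //; have [|_ _ ux] := u_le x Ox; first by rewrite d0.
  by apply: le_trans ux _; rewrite lee_fin.
exists c1, tau; split=> // x Ox dx; have [def1 def2 ux] := u_le x Ox dx.
split=> //; apply: le_trans ux _; rewrite lee_fin.
move: dx => /andP[d0 _].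
(* As [eta_k] is nonincreasing and [psi] nondecreasing, [g] is nonincreasing; [def1] keeps the
   smaller argument of [psi] above [beta0]. *)
have : g (c1 * dist x B) <= g (c2 * dist x B).
  rewrite gE; apply: psi_incr; first by case: def1.
  by apply: eta_k_le; rewrite ?mulr_gt0 ?ler_pM2r.
by lra.
Qed.
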